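(* Let $(A,\cdot)$ be an associative algebra over a field $K$. The class of proper totally compatible structures on $(A,\cdot)$ is closed under isomorphisms and antiisomorphisms; that is, if $*$ is a proper totally compatible structure on $(A,\cdot)$ and $\star$ is a totally compatible structure on $(A,\cdot)$ that is isomorphic or antiisomorphic to $*$, then $\star$ is proper.
   Context: All products are $K$-bilinear; algebras are not assumed unital. Two products $\cdot_1,\cdot_2$ on a vector space $V$ are totally compatible if $(a\cdot_1 b)\cdot_2 c=(a\cdot_2 b)\cdot_1 c=a\cdot_1(b\cdot_2 c)=a\cdot_2(b\cdot_1 c)$ for all $a,b,c\in V$. A totally compatible structure on an associative algebra $(A,\cdot)$ is an associative bilinear product $*$ on $A$ such that $\cdot$ and $*$ are totally compatible. The centroid $\Gamma(A)$ is the space of linear maps $\varphi:A\to A$ with $\varphi(a\cdot b)=a\cdot\varphi(b)=\varphi(a)\cdot b$ for all $a,b\in A$. For $\varphi\in\Gamma(A)$, the product $*_\varphi$ is $a*_\varphi b=\varphi(a\cdot b)$. A bilinear product $\bullet$ on $A$ is annihilator-valued (with respect to $\cdot$) if $(A\cdot A)\bullet A=(A\bullet A)\cdot A=A\cdot(A\bullet A)=A\bullet(A\cdot A)=\{0\}$, where a product of subspaces is the span of all products of elements. An annihilator-valued structure on $(A,\cdot)$ is an associative annihilator-valued bilinear product on $A$. A totally compatible structure on $(A,\cdot)$ is proper if it is of the form $*_\varphi+\bullet$ with $\varphi\in\Gamma(A)$ and $\bullet$ an annihilator-valued structure on $(A,\cdot)$. Two totally compatible structures $*_1,*_2$ on $(A,\cdot)$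 are isomorphic (resp. antiisomorphic) if there is an automorphism (resp. antiautomorphism) $\phi$ of $(A,\cdot)$ with $\phi(a*_1 b)=\phi(a)*_2\phi(b)$ (resp. $\phi(a*_1 b)=\phi(b)*_2\phi(a)$) for all $a,b\in A$. *)

(* Defs.v *)
From mathcomp Require Import all_boot all_algebra.
From mathcomp Require Import classical_sets.

Set Implicit Arguments.
Unset Strict Implicit.
Unset Printing Implicit Defensive.

Import GRing.Theory.
Local Open Scope ring_scope.
Local Open Scope classical_set_scope.

(* A K-algebra, not assumed unital or associative, is a K-vector space A of
   arbitrary dimension together with a product {bilinear A -> A -> A}. *)

Section Structures.
Context {K : fieldType} {A : lmodType K}.
Implicit Types (mul op : {bilinear A -> A -> A}) (phi : {linear A -> A}).

Definition totally_compatible op1 op2 : Prop :=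
  forall a b c : A,
    [/\ op2 (op1 a b) c = op1 (op2 a b) c,
        op1 (op2 a b) c = op1 a (op2 b c) &
        op1 a (op2 b c) = op2 a (op1 b c)].

Definition totally_compatible_structure mul op : Prop :=
  associative op /\ totally_compatible mul op.

Definition in_centroid mul phi : Prop :=
  forall a b : A, phi (mul a b) = mul a (phi b) /\ phi (mul a b) = mul (phi a) b.

Definition centroid_product mul phi (a b : A) : A := phi (mul a b).

Definition linear_span (S : set A) : set A :=
  [set x | exists (n : nat) (c : 'I_n -> K) (v : 'I_n -> A),
     (forall i, S (v i)) /\ x = \sum_(i < n) c i *: v i].

Definition subspace_product op (U V : set A) : set A :=
  linear_span [set op u v | u in U & v in V].

Definition annihilator_valued mul op : Prop :=
  [/\ subspace_product op (subspace_product mul setT setT) setT = [set 0],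
      subspace_product mul (subspace_product op setT setT) setT = [set 0],
      subspace_product mul setT (subspace_product op setT setT) = [set 0] &
      subspace_product op setT (subspace_product mul setT setT) = [set 0]].

Definition annihilator_valued_structure mul op : Prop :=
  associative op /\ annihilator_valued mul op.

Definition proper_structure mul op : Prop :=
  totally_compatible_structure mul op /\
  exists (phi : {linear A -> A}) (bul : {bilinear A -> A -> A}),
    [/\ in_centroid mul phi, annihilator_valued_structure mul bul &
        forall a b : A, op a b = centroid_product mul phi a b + bul a b].

Definition automorphism mul phi : Prop :=
  bijective phi /\ forall a b : A, phi (mul a b) = mul (phi a) (phi b).

Definition antiautomorphism mul phi : Prop :=
  bijective phi /\ forall a b : A, phi (mul a b) = mul (phi b) (phi a).

Definition isomorphic_structures mul op1 op2 : Prop :=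
  exists phi : {linear A -> A},
    automorphism mul phi /\
    forall a b : A, phi (op1 a b) = op2 (phi a) (phi b).

Definition antiisomorphic_structures mul op1 op2 : Prop :=
  exists phi : {linear A -> A},
    antiautomorphism mul phi /\
    forall a b : A, phi (op1 a b) = op2 (phi b) (phi a).

End Structures.

(* Main.v *)
(** Let [f] be the linear bijection from the target structure to the proper one,
    with inverse [g], and write the proper structure as [phi (a b) + bul a b].
    For an isomorphism, the target structure is given by the pulled back data
    [g \o phi \o f] and [g (bul (f a) (f b))]. An antiisomorphism is an
    isomorphism onto the opposite products, and properness is invariant under
    passing to opposite products. *)

Require Import Defs.
From HB Require Import structures.
From mathcomp Require Import all_boot all_algebra.
From mathcomp Require Import classical_sets.

Local Open Scope ring_scope.

Lemma linear_span_sub {K : fieldType} {A : lmodType K} (S : set A) x :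
  S x -> linear_span S x.
Proof.
move=> Sx; exists 1%N, (fun=> 1), (fun=> x); split=> //.
by rewrite big_ord1 GRing.scale1r.
Qed.

Lemma linear_span_eq0 {K : fieldType} {A : lmodType K} (S : set A) :
  linear_span S = [set 0]%classic <-> (forall x, S x -> x = 0).
Proof.
split=> [S0 x /linear_span_sub|S0]; first by rewrite S0.
rewrite eqEsubset; split=> [x [n [c [v [Sv ->]]]]|x ->] /=.
  by rewrite big1// => i _; rewrite (S0 _ (Sv i)) GRing.scaler0.
(* The empty combination puts [0] in the span even when [S] is empty. *)
by exists 0%N, (fun=> 0), (fun=> 0); split; [case | rewrite big_ord0].
Qed.

Lemma subspace_product_eq0 {K : fieldType} {A : lmodType K}
    (op : {bilinear A -> A -> A}) (U V : set A) :
  subspace_product op U V = [set 0]%classic <->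
  (forall u v, U u -> V v -> op u v = 0).
Proof.
rewrite /subspace_product linear_span_eq0; split=> [UV0 u v Uu Vv | UV0 x].
  by apply: UV0; exists u => //; exists v.
by move=> [u Uu [v Vv <-]]; exact: UV0.
Qed.

Lemma subspace_product_setTl_eq0 {K : fieldType} {A : lmodType K}
    (op1 op2 : {bilinear A -> A -> A}) :
  subspace_product op1 (subspace_product op2 setT setT) setT = [set 0]%classic
  <-> (forall a b c, op1 (op2 a b) c = 0).
Proof.
rewrite subspace_product_eq0; split=> [h a b c|h u c].
  by apply: h => //; apply: linear_span_sub; exists a => //; exists b.
move=> [n [k [v [Sv ->]]]] _; rewrite linear_sumlz big1// => i _.
by have [a _ [b _ <-]] := Sv i; rewrite linearZl_LR h GRing.scaler0.
Qed.

Lemma subspace_product_setTr_eq0 {K : fieldType} {A : lmodType K}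
    (op1 op2 : {bilinear A -> A -> A}) :
  subspace_product op1 setT (subspace_product op2 setT setT) = [set 0]%classic
  <-> (forall a b c, op1 a (op2 b c) = 0).
Proof.
rewrite subspace_product_eq0; split=> [h a b c|h a u _].
  by apply: h => //; apply: linear_span_sub; exists b => //; exists c.
move=> [n [k [v [Sv ->]]]]; rewrite linear_sumr big1// => i _.
by have [b _ [c _ <-]] := Sv i; rewrite linearZr_LR h GRing.scaler0.
Qed.

(** By bilinearity, vanishing on the generators of a product subspace gives vanishing on its span.
    The four subspace equalities thus become identities between elements, which can be transported
    by rewriting. *)
Lemma annihilator_valuedP {K : fieldType} {A : lmodType K}
    (mul op : {bilinear A -> A -> A}) :
  annihilator_valued mul op <->
  forall a b c, [/\ op (mul a b) c = 0, mul (op a b) c = 0,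
                    mul a (op b c) = 0 & op a (mul b c) = 0].
Proof.
rewrite /annihilator_valued; split.
  move=> [/subspace_product_setTl_eq0 h1 /subspace_product_setTl_eq0 h2
           /subspace_product_setTr_eq0 h3 /subspace_product_setTr_eq0 h4].
  by move=> a b c; split.
move=> h.
by split; rewrite ?subspace_product_setTl_eq0 ?subspace_product_setTr_eq0;
  move=> a b c; case: (h a b c).
Qed.

(** This is the existential half of [proper_structure]. Total compatibility of the target is given
    in the theorem, so only this half has to be transported. *)
Definition proper_decomposition {K : fieldType} {A : lmodType K}
    (mul op : {bilinear A -> A -> A}) : Prop :=
  exists (phi : {linear A -> A}) (bul : {bilinear A -> A -> A}),
    [/\ in_centroid mul phi, annihilator_valued_structure mul bul &
        forall a b : A, op a b = centroid_product mul phi a b + bul a b].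

Definition opposite_product {K : fieldType} {A : lmodType K}
    (op : {bilinear A -> A -> A}) (a b : A) : A := op b a.

Lemma opposite_product_bilinear {K : fieldType} {A : lmodType K}
    (op : {bilinear A -> A -> A}) :
  bilinear_for *:%R *:%R (opposite_product op).
Proof.
by split=> u c x y; rewrite /opposite_product; [exact: linearPr | exact: linearPl].
Qed.

HB.instance Definition _ (K : fieldType) (A : lmodType K)
    (op : {bilinear A -> A -> A}) :=
  bilinear_isBilinear.Build K A A A _ _ (opposite_product op)
    (opposite_product_bilinear op).

(** The same [phi] serves: reversing the products exchanges the two centroid conditions, and
    exchanges the annihilator identities in pairs, first with fourth and second with third. *)
Lemma proper_decomposition_opposite {K : fieldType} {A : lmodType K}
    (mul op : {bilinear A -> A -> A}) :
  proper_decomposition mul op ->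
  proper_decomposition (opposite_product mul) (opposite_product op).
Proof.
move=> [phi [bul [cphi [bulA /annihilator_valuedP bul0] opE]]].
exists phi, (opposite_product bul); split.
- by move=> a b; have [? ?] := cphi b a; split.
- split=> [a b c|]; first by rewrite /= /opposite_product bulA.
  by apply/annihilator_valuedP=> a b c; have [? ? ? ?] := bul0 c b a; split.
- by move=> a b; exact: opE.
Qed.

Definition pullback_product {K : fieldType} {A B : lmodType K}
    (f : {linear A -> B}) (g : {linear B -> A}) (op : {bilinear B -> B -> B})
    (a b : A) : A := g (op (f a) (f b)).

Lemma pullback_product_bilinear {K : fieldType} {A B : lmodType K}
    (f : {linear A -> B}) (g : {linear B -> A})
    (op : {bilinear B -> B -> B}) :
  bilinear_for *:%R *:%R (pullback_product f g op).
Proof.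
by split=> u c x y; rewrite /pullback_product GRing.linearP ?linearPl ?linearPr
  GRing.linearP.
Qed.

HB.instance Definition _ (K : fieldType) (A B : lmodType K)
    (f : {linear A -> B}) (g : {linear B -> A})
    (op : {bilinear B -> B -> B}) :=
  bilinear_isBilinear.Build K A A A _ _ (pullback_product f g op)
    (pullback_product_bilinear f g op).

(** Since [f] is injective, each identity may be checked after applying [f], where it becomes the
    corresponding identity for [phi] or [bul]. Keeping [mulA] and [mulB] separate allows [mulB] to
    be the opposite of [mulA]. *)
Lemma proper_decomposition_pullback {K : fieldType} {A B : lmodType K}
    (f : {linear A -> B})
    (mulA opA : {bilinear A -> A -> A}) (mulB opB : {bilinear B -> B -> B}) :
  bijective f ->
  (forall a b, f (mulA a b) = mulB (f a) (f b)) ->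
  (forall a b, f (opA a b) = opB (f a) (f b)) ->
  proper_decomposition mulB opB -> proper_decomposition mulA opA.
Proof.
move=> [g0 f0K g0K] fM fop [phi [bul [cphi [bulA /annihilator_valuedP bul0] opE]]].
(* The inverse of a linear bijection is linear; packing it makes [g \o phi \o f] linear and the
   pulled back product bilinear. *)
pose gL := GRing.isLinear.Build K B A _ g0 (GRing.can2_linear f0K g0K).
pose g : {linear B -> A} := HB.pack g0 gL.
have fK : cancel f g by [].
have gK : cancel g f by [].
have finj := can_inj fK.
exists (g \o phi \o f), (pullback_product f g bul); split.
- move=> a b; have [h1 h2] := cphi (f a) (f b).
  by split; apply: finj; rewrite /= !fM !gK.
- split=> [a b c|]; first by rewrite /= /pullback_product !gK bulA.
  apply/annihilator_valuedP=> a b c; have [h1 h2 h3 h4] := bul0 (f a) (f b) (f c).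
  by split; apply: finj; rewrite /= /pullback_product ?fM ?gK ?fM GRing.linear0.
- move=> a b; apply: finj.
  by rewrite fop opE /centroid_product /= /pullback_product GRing.linearD !gK fM.
Qed.

Theorem proposition3p14 (K : fieldType) (A : lmodType K)
    (mul : {bilinear A -> A -> A}) (mul_assoc : associative mul)
    (ast star : {bilinear A -> A -> A})
    (ast_proper : proper_structure mul ast)
    (star_tc : totally_compatible_structure mul star)
    (star_iso : isomorphic_structures mul star ast \/
                antiisomorphic_structures mul star ast) :
  proper_structure mul star.
Proof.
have [_ ast_dec] := ast_proper; split=> //.
(* In both cases [f] maps the structure [star] to [ast], the direction needed to pull the
   decomposition of [ast] back. *)
have [[f [[f_bij fM] fstar]] | [f [[f_bij fM] fstar]]] := star_iso.
  exact: proper_decomposition_pullback f_bij fM fstar ast_dec.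
(* Here [mul (f b) (f a)] is [opposite_product mul (f a) (f b)] by unfolding, and likewise for
   [ast], so [fM] and [fstar] are exactly the two homomorphism conditions. *)
apply: proper_decomposition_pullback f_bij _ _
  (proper_decomposition_opposite _ _ ast_dec).
  exact: fM.
exact: fstar.
Qed.
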